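(* Let $X$ be a non-negative random variable with pdf $f$ and cdf $F$, let $n$ be a positive integer, and let $\alpha>0$, $\alpha\neq 1$. Then $$(1-\alpha)S_{\alpha}(\boldsymbol X_{\rm MRSSU})+1\;\leq\;(n!)^{\alpha}\left[(1-\alpha)S_{\alpha}(\boldsymbol X_{\rm SRS})+1\right].$$
   Context: $X$ is a non-negative, absolutely continuous random variable with pdf $f$ and cdf $F$. $\boldsymbol X_{\rm SRS}=(X_1,\dots,X_n)$ is a simple random sample (i.i.d. copies of $X$) of size $n$. $\boldsymbol X_{\rm MRSSU}$ (maximum ranked set sampling with unequal samples) is a vector of $n$ independent random variables whose $i$-th component is the maximum $X_{(i:i)}$ of a simple random sample of size $i$ from $X$; it has pdf $i f(x)[F(x)]^{i-1}$. The Tsallis entropies of order $\alpha>0$, $\alpha\ne1$, are $$S_{\alpha}(\boldsymbol X_{\rm SRS})=\frac{1}{1-\alpha}\left(\left[\int_{0}^{1}f^{\alpha-1}(F^{-1}(u))\,du\right]^{n}-1\right),$$ $$S_{\alpha}(\boldsymbol X_{\rm MRSSU})=\frac{1}{1-\alpha}\left(\prod_{i=1}^{n}\left[\int_{0}^{1}i^{\alpha}u^{\alpha(i-1)}f^{\alpha-1}(F^{-1}(u))\,du\right]-1\right),$$ where $F^{-1}$ is the right-continuous inverse of $F$ and $f^{\alpha-1}(F^{-1}(u))=[f(F^{-1}(u))]^{\alpha-1}$. *)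

(* Defs.v *)
From HB Require Import structures.
From mathcomp Require Import all_boot all_order all_algebra.
From mathcomp Require Import all_classical all_reals all_analysis.

Set Implicit Arguments.
Unset Strict Implicit.
Unset Printing Implicit Defensive.
Import Order.TTheory GRing.Theory Num.Theory.
Import numFieldNormedType.Exports.

Local Open Scope classical_set_scope.
Local Open Scope ring_scope.
Local Open Scope ereal_scope.

Definition is_pdf d (T : measurableType d) (R : realType)
    (P : probability T R) (X : {RV P >-> R}) (f : R -> R) : Prop :=
  [/\ measurable_fun [set: R] f,
      forall x, (0 <= f x)%R &
      forall A : set R, measurable A ->
        distribution P X A = \int[lebesgue_measure]_(x in A) (f x)%:E].

(* For X >= 0 a.s. and 0 <= u < 1, the set below is nonempty and bounded
   below, so this real-valued inf is the true one; at u = 1 the set is empty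
   and [inf] returns the default value 0. *)
Definition right_cont_inverse d (T : measurableType d) (R : realType)
    (P : probability T R) (X : {RV P >-> R}) (u : R) : R :=
  inf [set x : R | u%:E < cdf X x].

(* Tsallis entropies of order alpha.  The integrals may diverge, so they are
   extended reals and so are the entropies.  Integrals are taken over ]0, 1[,
   where the inverse cdf needs no convention.  As [0 `^ (alpha - 1) = 0] even
   when alpha < 1, the zeros of f contribute 0; the set of u with
   f (F^-1 u) = 0 is Lebesgue-null in any case. *)
Definition tsallis_SRS d (T : measurableType d) (R : realType)
    (P : probability T R) (X : {RV P >-> R}) (f : R -> R)
    (alpha : R) (n : nat) : \bar R :=
  ((1 - alpha)^-1)%:E *
  ((\int[lebesgue_measure]_(u in `]0%R, 1%R[)
      (f (right_cont_inverse X u) `^ (alpha - 1))%:E) ^+ n - 1).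

Definition tsallis_MRSSU d (T : measurableType d) (R : realType)
    (P : probability T R) (X : {RV P >-> R}) (f : R -> R)
    (alpha : R) (n : nat) : \bar R :=
  ((1 - alpha)^-1)%:E *
  (\prod_(1 <= i < n.+1)
     (\int[lebesgue_measure]_(u in `]0%R, 1%R[)
        (i%:R `^ alpha * u `^ (alpha * (i%:R - 1)) *
         f (right_cont_inverse X u) `^ (alpha - 1))%:E) - 1).

(* Main.v *)
(** Since [u `^ (alpha (i - 1)) <= 1] on ]0, 1[, the [i]-th factor of the MRSSU
    product is at most [i ^ alpha] times the SRS integral; multiplying over [i]
    produces [n! ^ alpha].  Every term is a nonnegative extended real, so the
    argument also covers divergent integrals. *)
Require Import Defs.
From mathcomp Require Import all_boot all_order all_algebra.
From mathcomp Require Import all_classical all_reals all_analysis.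
From mathcomp Require Import measurable_realfun.
Import Order.TTheory GRing.Theory Num.Theory.
Import numFieldNormedType.Exports.
Local Open Scope ring_scope.
Local Open Scope ereal_scope.

(** The set is nonempty because the cdf tends to 1 > [u] at +oo, and bounded below because the cdf
    tends to 0 < [u] at -oo. *)
Lemma has_inf_cdf_gt (d : measure_display) (T : measurableType d)
    (R : realType) (P : probability T R) (X : {RV P >-> R}) (u : R) :
  (0 < u < 1)%R -> has_inf [set x : R | u%:E < cdf X x]%classic.
Proof.
move=> /andP[u0 u1]; split.
- have u_nbhs : nbhs (1%:E : \bar R) [set y | u%:E < y]%classic.
    by apply: open_ereal_gt'; rewrite lte_fin.
  by have /pinfty_ex_gt0[x _ /= ux] := cvg_cdfy1 X u_nbhs; exists x.
- have u_nbhs : nbhs (0%:E : \bar R) [set y | y < u%:E]%classic.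
    by apply: open_ereal_lt'; rewrite lte_fin.
  have [m [_ cdf_lt]] := cvg_cdfNy0 X u_nbhs.
  exists m => x /= ux; rewrite leNgt; apply/negP => /cdf_lt /=.
  by rewrite ltNge (ltW ux).
Qed.

(** Raising the level shrinks the set whose infimum is taken; levels inside ]0, 1[ keep both infima
    genuine. *)
Lemma right_cont_inverse_le (d : measure_display) (T : measurableType d)
    (R : realType) (P : probability T R) (X : {RV P >-> R}) (u v : R) :
  (0 < u)%R -> (u <= v)%R -> (v < 1)%R ->
  (right_cont_inverse X u <= right_cont_inverse X v)%R.
Proof.
move=> u0 uv v1.
have [_ lbu] : has_inf [set x : R | u%:E < cdf X x]%classic.
  by apply: has_inf_cdf_gt; rewrite u0 (le_lt_trans uv).
have [v_ex _] : has_inf [set x : R | v%:E < cdf X x]%classic.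
  by apply: has_inf_cdf_gt; rewrite v1 (lt_le_trans u0).
apply: lb_le_inf => // x /= vx; apply: ge_inf => //=.
by apply: le_lt_trans vx; rewrite lee_fin.
Qed.

(** By monotonicity, the preimage in ]0, 1[ of each ray [[r, +oo[] is an interval, and these rays
    generate the Borel sets. *)
Lemma measurable_right_cont_inverse (d : measure_display)
    (T : measurableType d) (R : realType) (P : probability T R)
    (X : {RV P >-> R}) :
  measurable_fun (`]0%R, 1%R[%classic : set R) (right_cont_inverse X).
Proof.
move=> mD; apply: (measurability (@RGenCInfty.G R)) => //.
  exact: RGenCInfty.measurableE.
move=> _ /= [_ [r] -> <-].
apply: is_interval_measurable => s t /=; rewrite !in_itv /= !andbT.
move=> [/andP[s0 s1] rs] [/andP[t0 t1] _] u /andP[su ut].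
have u0 := lt_le_trans s0 su; have u1 := le_lt_trans ut t1.
rewrite !in_itv/= u0 u1 andbT; split => //.
by rewrite (le_trans rs) // right_cont_inverse_le.
Qed.

(** Undoes the normalisation in the Tsallis entropies. It holds for infinite [y] too, since [a] is
    real and nonzero and the subtracted 1 is finite. *)
Lemma mule_subeK (R : realType) (a : R) (y : \bar R) : a != 0%R ->
  a%:E * ((a^-1)%:E * (y - 1)) + 1 = y.
Proof. by move=> a0; rewrite muleA -EFinM divff // mul1e subeK. Qed.

Lemma integral_mulpowR_le (R : realType) (c b : R) (g : R -> R) :
  (0 <= c)%R -> (0 <= b)%R -> (forall u, 0 <= g u)%R ->
  measurable_fun (`]0%R, 1%R[%classic : set R) g ->
  \int[lebesgue_measure]_(u in `]0%R, 1%R[) (c * u `^ b * g u)%:E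
  <= c%:E * \int[lebesgue_measure]_(u in `]0%R, 1%R[) (g u)%:E.
Proof.
move=> c0 b0 g0 mg; rewrite -ge0_integralZl_EFin //; first last.
- exact/measurable_EFinP.
- by move=> u _; rewrite lee_fin.
apply: ge0_le_integral => //.
- by move=> u _; rewrite lee_fin !mulr_ge0 // powR_ge0.
- apply/measurable_EFinP; apply: measurable_funM => //.
  apply: measurable_funM => //.
  by apply: measurable_funTS; exact: measurable_powR.
- by apply: measurable_funeM; exact/measurable_EFinP.
move=> u /=; rewrite in_itv /= => /andP[u0 u1].
rewrite -EFinM lee_fin ler_wpM2r // ler_piMr //.
(* Here [u < 1] and [b >= 0] give [u]^ b <= 1 [^ b = 1]. *)
by rewrite (le_trans (ge0_ler_powR b0 _ _ (ltW u1))) ?powR1 // nnegrE ltW.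
Qed.

Lemma prode_le_factorial (R : realType) (alpha : R) (I : \bar R)
    (J : nat -> \bar R) (n : nat) :
  0 <= I -> (forall i, 0 <= J i) ->
  (forall i, (0 < i)%N -> J i <= (i%:R `^ alpha)%:E * I) ->
  \prod_(1 <= i < n.+1) J i <= ((n`!)%:R `^ alpha)%:E * I ^+ n.
Proof.
move=> I0 J0 JI; elim: n => [|n IHn].
  by rewrite big_geq // fact0 powR1 mul1e.
(* The right side regroups as the bound on the new factor [J n.+1] times the bound from the
   induction hypothesis. *)
rewrite expeS big_nat_recr //= factS natrM powRM // EFinM muleACA muleC.
by apply: lee_pmul => //; [exact: prode_ge0 | exact: JI].
Qed.

Theorem theorem2p1 (d : measure_display) (T : measurableType d) (R : realType)
    (P : probability T R) (X : {RV P >-> R}) (f : R -> R)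
    (n : nat) (alpha : R)
    (hX : {ae P, forall w, (0 <= X w)%R})
    (hf : is_pdf X f)
    (hn : (0 < n)%N)
    (halpha : (0 < alpha)%R) (halpha1 : alpha <> 1%R) :
  (1 - alpha)%:E * tsallis_MRSSU X f alpha n + 1
  <= ((n`!)%:R `^ alpha)%:E * ((1 - alpha)%:E * tsallis_SRS X f alpha n + 1).
Proof.
have a1 : (1 - alpha != 0)%R by rewrite subr_eq0 eq_sym; exact/eqP.
(* What remains compares the product of the MRSSU integrals with the [n]-th power of the SRS
   integral, whatever the sign of [1 - alpha]. *)
rewrite /tsallis_MRSSU /tsallis_SRS !mule_subeK //.
have [mf _ _] := hf.
apply: prode_le_factorial => [|i|i i0].
- by apply: integral_ge0 => u _; rewrite lee_fin powR_ge0.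
- by apply: integral_ge0 => u _; rewrite lee_fin !mulr_ge0 // powR_ge0.
apply: integral_mulpowR_le => [|||].
- exact: powR_ge0.
(* The exponent [alpha * (i - 1)] is nonnegative because the product starts at [i = 1]. *)
- by rewrite mulr_ge0 ?(ltW halpha) // subr_ge0 ler1n.
- by move=> u; exact: powR_ge0.
apply: (measurableT_comp (measurable_powR (alpha - 1))).
exact: (measurableT_comp mf (measurable_right_cont_inverse _ _ _ _ X)).
Qed.
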